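(* Let $K$ be the graph obtained from the complete graph $K_4$ by subdividing one of its edges once; label its vertices $v_1,\dots,v_5$ so that $v_1$ is the subdivision vertex, $E(K)=\{v_1v_2,v_1v_3,v_2v_4,v_2v_5,v_3v_4,v_3v_5,v_4v_5\}$. Let $G$ be any cubic graph containing $K$ as a subgraph, and let $b$ denote the edge of $G$ incident to $v_1$ that is not in $K$ (a bridge of $G$). Then: (a) in any normal edge-coloring of $G$, all edges of $K$ are rich; (b) in any normal edge-coloring of $G$, the seven edges of $K$ receive pairwise different colors; (c) $\chi'_N(G)\geq 7$, i.e., $G$ admits no normal $k$-edge-coloring with $k\leq 6$; (d) in any normal $7$-edge-coloring of $G$, the edges $v_4v_5$ and $b$ receive the same color.
   Context: Graphs may have parallel edges but no loops. A $k$-edge-coloring of a graph is an assignment of colors from $\{1,\dots,k\}$ to its edges such that adjacent edges receive different colors. For an edge-coloring $c$ and a vertex $v$, let $S_c(v)$ be the set of colors of the edges incident to $v$. In a cubic graph, an edge $uv$ is poor with respect to $c$ if $|S_c(u)\cup S_c(v)|=3$ and rich if $|S_c(u)\cup S_c(v)|=5$. An edge-coloring of a cubic graph is normal if every edge is poor or rich. $\chi'_N(G)$ denotes the smallest $k$ such that $G$ admits a normal $k$-edge-coloring. *)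

(* Defs.v *)
From mathcomp Require Import all_boot.

Set Implicit Arguments.
Unset Strict Implicit.
Unset Printing Implicit Defensive.

(* Parallel edges are distinct elements of [edge] with the same set of ends;
   [card_ends] excludes loops. *)
Record multigraph := Multigraph {
  vertex : finType;
  edge : finType;
  ends : edge -> {set vertex};
  card_ends : forall e, #|ends e| = 2
}.

Definition edges_at (G : multigraph) (v : vertex G) : {set edge G} :=
  [set e | v \in ends e].

Definition cubic (G : multigraph) : Prop :=
  forall v : vertex G, #|edges_at v| = 3.

Definition adjacent_edges (G : multigraph) (e f : edge G) : bool :=
  (e != f) && (ends e :&: ends f != set0).

Definition edge_coloring (G : multigraph) (k : nat) (c : edge G -> 'I_k) :
    Prop :=
  forall e f : edge G, adjacent_edges e f -> c e <> c f.

Definition colors_at (G : multigraph) (k : nat) (c : edge G -> 'I_k)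
    (v : vertex G) : {set 'I_k} :=
  [set c e | e in edges_at v].

(* S_c(u) :|: S_c(v), where u and v are the two ends of e. *)
Definition colors_around (G : multigraph) (k : nat) (c : edge G -> 'I_k)
    (e : edge G) : {set 'I_k} :=
  \bigcup_(v in ends e) colors_at c v.

Definition poor (G : multigraph) (k : nat) (c : edge G -> 'I_k) (e : edge G) :
    Prop :=
  #|colors_around c e| = 3.

Definition rich (G : multigraph) (k : nat) (c : edge G -> 'I_k) (e : edge G) :
    Prop :=
  #|colors_around c e| = 5.

Definition normal_coloring (G : multigraph) (k : nat) (c : edge G -> 'I_k) :
    Prop :=
  edge_coloring c /\ forall e : edge G, poor c e \/ rich c e.

Definition normal_colorable (G : multigraph) (k : nat) : Prop :=
  exists c : edge G -> 'I_k, normal_coloring c.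

(* [normal_index G n] means chi'_N(G) = n. It is a relation because some cubic
   graphs with parallel edges have no normal edge-coloring at all. *)
Definition normal_index (G : multigraph) (n : nat) : Prop :=
  normal_colorable G n /\ forall k : nat, normal_colorable G k -> n <= k.

Definition joined_avoiding (G : multigraph) (b : edge G) : rel (vertex G) :=
  fun u v => [exists e : edge G, (e != b) && (ends e == [set u; v])].

(* A bridge is an edge that separates its ends. *)
Definition bridge (G : multigraph) (b : edge G) : Prop :=
  forall u v : vertex G,
    ends b = [set u; v] -> ~~ connect (joined_avoiding b) u v.

(* A (not necessarily induced) subgraph of G isomorphic to H. *)
Record subgraph_copy (H G : multigraph) := SubgraphCopy {
  on_vertex : vertex H -> vertex G;
  on_edge : edge H -> edge G;
  on_vertex_inj : injective on_vertex;
  on_edge_inj : injective on_edge;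
  ends_on_edge : forall e, ends (on_edge e) = [set on_vertex x | x in ends e]
}.

(* K_4 with one edge subdivided once: the subdivided edge is v_2 v_3. *)
Definition K_v1 : 'I_5 := @Ordinal 5 0 isT.
Definition K_v2 : 'I_5 := @Ordinal 5 1 isT.
Definition K_v3 : 'I_5 := @Ordinal 5 2 isT.
Definition K_v4 : 'I_5 := @Ordinal 5 3 isT.
Definition K_v5 : 'I_5 := @Ordinal 5 4 isT.

Definition K_pairs : 7.-tuple ('I_5 * 'I_5) :=
  [tuple (K_v1, K_v2); (K_v1, K_v3); (K_v2, K_v4); (K_v2, K_v5);
         (K_v3, K_v4); (K_v3, K_v5); (K_v4, K_v5)].

Definition K_ends (i : 'I_7) : {set 'I_5} :=
  [set (tnth K_pairs i).1; (tnth K_pairs i).2].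

Lemma card_K_ends (i : 'I_7) : #|K_ends i| = 2.
Proof. by rewrite cards2; case: i; do 7?[case=> //]. Qed.

Definition K_graph : multigraph := Multigraph card_K_ends.

Definition K_e45 : edge K_graph := @Ordinal 7 6 isT.

Lemma ends_K_e45 : ends K_e45 = [set K_v4; K_v5].
Proof. by []. Qed.

(* b is an edge of G incident to v_1 that is not in the copy of K. *)
Definition pendant_edge (G : multigraph) (h : subgraph_copy K_graph G)
    (b : edge G) : Prop :=
  on_vertex h K_v1 \in ends b /\ forall e : edge K_graph, on_edge h e <> b.

(* Main.v *)
Require Import Defs.
From mathcomp Require Import all_boot.

(** If an edge [e = uv] of a cubic graph has further edges [x, y] at [u] and
    [z, w] at [v], then [e] is poor or rich exactly when the color pairs of
    [x, y] and [z, w] are equal or disjoint. In [K], equality at any edge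
    propagates along neighbouring edges until two adjacent edges share a color,
    so all edges are rich; richness then separates all nonadjacent pairs of
    edges of [K], and separates the pendant edge from all of [K] but [v4v5].
    All edges at [v2, ..., v5] belong to [K], so the vertex set
    of [K] is closed in [G - b] and [b] is a bridge. *)

Set Implicit Arguments.
Unset Strict Implicit.
Unset Printing Implicit Defensive.

Lemma uniq_map_inj_in (T1 T2 : eqType) (f : T1 -> T2) (s : seq T1) :
  uniq (map f s) -> {in s &, injective f}.
Proof.
elim: s => //= z s IHs /andP[fz fs] x y; rewrite !inE.
case/predU1P=> [->|xs] /predU1P[->|ys] // fE.
- by rewrite fE map_f in fz.
- by rewrite -fE map_f in fz.
- exact: IHs fE.
Qed.

(** * Equal and disjoint pairs of colors *)

Section ColorPairs.

Variable T : eqType.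
Implicit Types a b d p q r s t x y z w : T.

Definition same_pair x y z w : bool :=
  (x == z) && (y == w) || (x == w) && (y == z).

Definition disjoint_pair x y z w : bool :=
  [&& x != z, x != w, y != z & y != w].

Definition normal_pair x y z w : bool :=
  same_pair x y z w || disjoint_pair x y z w.

Lemma normal_pairP x y z w : normal_pair x y z w ->
  [\/ x = z /\ y = w, x = w /\ y = z | disjoint_pair x y z w].
Proof.
by case/orP=> [/orP[]/andP[/eqP-> /eqP->] |];
  [constructor 1 | constructor 2 | constructor 3].
Qed.

Lemma disjoint_pairP x y z w : disjoint_pair x y z w ->
  [/\ x <> z, x <> w, y <> z & y <> w].
Proof. by case/and4P=> *; split; apply/eqP. Qed.

Lemma uniq3P x y z : uniq [:: x; y; z] -> [/\ x <> y, x <> z & y <> z].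
Proof.
rewrite /= !inE andbT negb_or => /andP[/andP[xy xz] yz].
by split; apply/eqP.
Qed.

(* The variables are the colors of v1v2, v1v3, v2v4, v2v5, v3v4, v3v5, v4v5
   and of the pendant edge at v1, in this order. *)
Lemma K_colors_distinct a d p q r s t b :
    uniq [:: a; d; b] -> uniq [:: a; p; q] -> uniq [:: d; r; s] ->
    uniq [:: t; p; r] -> uniq [:: t; q; s] ->
    normal_pair d b p q -> normal_pair a b r s ->
    normal_pair a q r t -> normal_pair a p s t ->
    normal_pair d s p t -> normal_pair d r q t ->
    normal_pair p r q s ->
  uniq [:: a; d; p; q; r; s; t] && (b \notin [:: a; d; p; q; r; s]).
Proof.
move=> /uniq3P[? ? ?] /uniq3P[? ? ?] /uniq3P[? ? ?] /uniq3P[? ? ?].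
move=> /uniq3P[? ? ?] Ha Hd Hp Hq Hr Hs Ht.
(* Equality [p = q] clashes at [v2]. If [p = s] and [r = q], then normality of [v2v4] forces [a = t]
   and normality of [v3v4] forces [d = t], although [v1v2] and [v1v3] are adjacent. *)
have {}Ht : disjoint_pair p r q s.
  case: (normal_pairP Ht) => // -[? ?]; first congruence.
  case: (normal_pairP Hp) => [[? ?]|[? ?]|/disjoint_pairP[? ? ? ?]];
  case: (normal_pairP Hr) => [[? ?]|[? ?]|/disjoint_pairP[? ? ? ?]]; congruence.
have [? ? ? ?] := disjoint_pairP Ht.
have dis x y z w : normal_pair x y z w ->
    ~ (x = z /\ y = w) -> ~ (x = w /\ y = z) ->
    [/\ x <> z, x <> w, y <> z & y <> w].
  by move=> /normal_pairP[//|//|/disjoint_pairP].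
(* The order matters: disjointness at [v4v5] rules out equal pairs at its four neighbouring edges,
   and these in turn rule them out at [v1v2] and [v1v3]. *)
have [||? ? ? ?] := dis _ _ _ _ Hp; [intuition congruence..|].
have [||? ? ? ?] := dis _ _ _ _ Hq; [intuition congruence..|].
have [||? ? ? ?] := dis _ _ _ _ Hr; [intuition congruence..|].
have [||? ? ? ?] := dis _ _ _ _ Hs; [intuition congruence..|].
have [||? ? ? ?] := dis _ _ _ _ Ha; [intuition congruence..|].
have [||? ? ? ?] := dis _ _ _ _ Hd; [intuition congruence..|].
rewrite /= !inE !negb_or.
by do ![apply/andP; split=> //]; apply/eqP; congruence.
Qed.

End ColorPairs.

(** The set has 5, 4 or 3 elements according to whether the two pairs share no, one or two colors,
    so the sizes 3 and 5 exclude exactly the case of one shared color. *)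
Lemma card_color_pairs (T : finType) (e x y z w : T) :
    uniq [:: e; x; y] -> uniq [:: e; z; w] ->
  [/\ #|[set e; x; y; z; w]| = 3 \/ #|[set e; x; y; z; w]| = 5 ->
        normal_pair x y z w
    & disjoint_pair x y z w -> #|[set e; x; y; z; w]| = 5].
Proof.
rewrite -!setUA !cardsU1 cards1 !inE /normal_pair /same_pair /disjoint_pair /=.
rewrite !inE !andbT => /andP[/norP[/negPf-> /negPf->] xy].
move=> /andP[/norP[/negPf-> /negPf->] /negPf zw].
rewrite (negPf xy) zw /=.
split; last by move=> /and4P[/negPf-> /negPf-> /negPf-> /negPf->].
have [?|_] := eqVneq x z; have [?|_] := eqVneq x w;
  have [?|_] := eqVneq y z; have [?|_] := eqVneq y w; subst;
  by rewrite ?eqxx // in xy zw *; case.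
Qed.

(** * Poor and rich edges in terms of the edges at their two ends *)

Section CubicGraph.

Variable G : multigraph.
Hypothesis hG : cubic G.

(** In a cubic graph a star of three edges is everything at [u]. The length is left free because
    [v1] has only two edges in [K_graph]. *)
Definition star (u : vertex G) (s : seq (edge G)) : bool :=
  uniq s && all (fun e => u \in ends e) s.

(** The pairs [x, y] and [z, w] may overlap, since an edge parallel to [e] occurs on both sides. *)
Definition flanked (e x y z w : edge G) : Prop :=
  exists u v, [/\ u != v, star u [:: e; x; y] & star v [:: e; z; w]].

Lemma edges_at_star u e x y : star u [:: e; x; y] ->
  edges_at u = [set e; x; y].
Proof.
case/andP=> es /allP ends_u; apply/esym/eqP; rewrite eqEcard hG.
apply/andP; split.
  apply/subsetP=> f; rewrite !inE -orbA => fe.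
  by apply: ends_u; rewrite !inE.
move: es; rewrite /= !inE -setUA !cardsU1 cards1 !inE andbT.
by case/andP=> -> ->.
Qed.

Variables (k : nat) (c : edge G -> 'I_k).

Lemma uniq_star_colors u e x y : edge_coloring c ->
  star u [:: e; x; y] -> uniq [:: c e; c x; c y].
Proof.
move=> hc /andP[es /and4P[ue ux uy _]].
have cN f g : u \in ends f -> u \in ends g -> f != g -> c f != c g.
  move=> uf ug fg; apply/eqP; apply: hc; rewrite /adjacent_edges fg /=.
  by apply/set0Pn; exists u; rewrite inE uf.
move: es; rewrite /= !inE !andbT !negb_or => /andP[/andP[ex ey] xy].
by rewrite !cN.
Qed.

Lemma colors_around_star u v e x y z w : u != v ->
    star u [:: e; x; y] -> star v [:: e; z; w] ->
  colors_around c e = [set c e; c x; c y; c z; c w].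
Proof.
move=> uv su sv.
have -> : colors_around c e = colors_at c u :|: colors_at c v.
  have -> : colors_around c e = \bigcup_(i in [set u; v]) colors_at c i.
    rewrite /colors_around; suff -> : ends e = [set u; v] by [].
    apply/esym/eqP; rewrite eqEcard card_ends cards2 uv andbT.
    apply/subsetP=> i; rewrite !inE => /orP[]/eqP->.
      by case/and3P: su.
    by case/and3P: sv.
  by rewrite bigcup_setU !big_set1.
rewrite /colors_at (edges_at_star su) (edges_at_star sv) !imsetU !imset_set1.
by apply/setP=> i; rewrite !inE; do ![case: (i == _) => //=].
Qed.

Lemma flanked_normal e x y z w : normal_coloring c ->
  flanked e x y z w -> normal_pair (c x) (c y) (c z) (c w).
Proof.
move=> [hc nc] [u [v [uv su sv]]].
have [+ _] := card_color_pairs (uniq_star_colors hc su) (uniq_star_colors hc sv).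
by apply; move: (nc e); rewrite /poor /rich (colors_around_star uv su sv).
Qed.

Lemma flanked_rich e x y z w : edge_coloring c ->
  flanked e x y z w -> disjoint_pair (c x) (c y) (c z) (c w) -> rich c e.
Proof.
move=> hc [u [v [uv su sv]]].
have [_] := card_color_pairs (uniq_star_colors hc su) (uniq_star_colors hc sv).
by rewrite /rich (colors_around_star uv su sv).
Qed.

End CubicGraph.

(** * The seven edges of [K_graph] by name *)

Definition K_e12 : edge K_graph := @Ordinal 7 0 isT.
Definition K_e13 : edge K_graph := @Ordinal 7 1 isT.
Definition K_e24 : edge K_graph := @Ordinal 7 2 isT.
Definition K_e25 : edge K_graph := @Ordinal 7 3 isT.
Definition K_e34 : edge K_graph := @Ordinal 7 4 isT.
Definition K_e35 : edge K_graph := @Ordinal 7 5 isT.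

Lemma K_edge_ind (P : edge K_graph -> Prop) :
    P K_e12 -> P K_e13 -> P K_e24 -> P K_e25 -> P K_e34 -> P K_e35 ->
    P K_e45 ->
  forall e, P e.
Proof.
move=> P0 P1 P2 P3 P4 P5 P6 [i lti].
do 7?[case: i lti => [|i] lti; first by rewrite (bool_irrelevance lti isT)].
by [].
Qed.

(** * The copy of [K_graph] in a cubic graph, and its pendant edge *)

Section CopyOfK.

Variable G : multigraph.
Hypothesis hG : cubic G.
Variable h : subgraph_copy K_graph G.

Local Notation V := (on_vertex h).
Local Notation E := (on_edge h).

Lemma mem_ends_copy x e : (V x \in ends (E e)) = (x \in ends e).
Proof. by rewrite ends_on_edge mem_imset //; apply: on_vertex_inj. Qed.

Lemma star_copy x s : star x s -> star (V x) (map E s).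
Proof.
case/andP=> us sx; rewrite /star map_inj_uniq ?us; last exact: on_edge_inj.
by rewrite all_map; apply: sub_all sx => e /=; rewrite mem_ends_copy.
Qed.

(** Three edges of the copy already exhaust the degree of [V x]. *)
Lemma edges_at_copy x e f g b : star x [:: e; f; g] -> V x \in ends b ->
  exists i, b = E i.
Proof.
move=> /star_copy/(edges_at_star hG)/setP/(_ b); rewrite !inE => -> /=.
by case/orP=> [/orP[]|] /eqP->; [exists e | exists f | exists g].
Qed.

Let star_v1 : star (K_v1 : vertex K_graph) [:: K_e12; K_e13].
Proof. by rewrite /star /= !inE. Qed.

Let inner_star (x : vertex K_graph) :
  x != K_v1 -> exists e f g, star x [:: e; f; g].
Proof.
case: x => -[|[|[|[|[|//]]]]] ltx // _.
- by exists K_e12, K_e24, K_e25; rewrite /star /= !inE.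
- by exists K_e13, K_e34, K_e35; rewrite /star /= !inE.
- by exists K_e24, K_e34, K_e45; rewrite /star /= !inE.
- by exists K_e25, K_e35, K_e45; rewrite /star /= !inE.
Qed.

Lemma pendant_edge_star b : pendant_edge h b ->
  star (V K_v1) [:: E K_e12; E K_e13; b].
Proof.
move=> [vb Eb]; have /andP[] := star_copy star_v1.
rewrite /star /= !inE vb !andbT negb_or => -> /andP[-> ->].
by rewrite !andbT /=; apply/andP; split; apply/eqP/Eb.
Qed.

Lemma pendant_edge_exists :
  exists b, forall b', pendant_edge h b' <-> b' = b.
Proof.
have /andP[us /and3P[v12 v13 _]] := star_copy star_v1.
have sub : [set E K_e12; E K_e13] \subset edges_at (V K_v1).
  by apply/subsetP=> e; rewrite !inE => /orP[]/eqP->.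
(* The copy uses at most two of the three edges at [V K_v1], so one is left over. *)
have [b bP] : exists b, b \in edges_at (V K_v1) :\: [set E K_e12; E K_e13].
  apply/set0Pn; rewrite -card_gt0 cardsD (setIidPr sub) hG cards2.
  by case: (_ != _).
have pb : pendant_edge h b.
  move: bP; rewrite !inE negb_or => /andP[/andP[b12 b13] vb]; split=> // e ebE.
  move: vb b12 b13; rewrite -ebE mem_ends_copy !(inj_eq (@on_edge_inj _ _ h)).
  by elim/K_edge_ind: e {ebE}; rewrite !inE.
exists b => b'; split=> [[vb' Eb']|-> //].
have /setP/(_ b') := edges_at_star hG (pendant_edge_star pb).
rewrite !inE vb' => /esym/orP[/orP[]|] /eqP // ebE.
  by case: (Eb' K_e12).
by case: (Eb' K_e13).
Qed.

(** A step out of the copy would need an edge outside it at one of its vertices. The vertices [v2]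
    to [v5] have none, and [v1] has only [b]. *)
Lemma closed_copy b : pendant_edge h b -> closed (joined_avoiding b) (codom V).
Proof.
move=> pb.
have stay e u v : e != b -> ends e = [set u; v] ->
    u \in codom V -> v \in codom V.
  move=> eb euv /codomP[x ux]; subst u.
  have vx : V x \in ends e by rewrite euv set21.
  have [i ei] : exists i, e = E i.
    have [xv1|/inner_star[e1 [e2 [e3 sx]]]] := eqVneq x K_v1; last first.
      exact: edges_at_copy sx vx.
    have /setP/(_ e) := edges_at_star hG (pendant_edge_star pb).
    rewrite !inE -xv1 vx (negPf eb) orbF => /esym/orP[]/eqP->;
      by [exists K_e12 | exists K_e13].
  have : v \in ends (E i) by rewrite -ei euv set22.
  by rewrite ends_on_edge => /imsetP[y _ ->]; apply: codom_f.
move=> u v /existsP[e /andP[eb /eqP euv]]; apply/idP/idP.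
  exact: stay eb euv.
by apply: stay eb _; rewrite setUC.
Qed.

(** The far end of [b] lies outside the copy: it is not [v1] since there are no loops, and the other
    copied vertices are saturated. Hence a set closed in [G - b] contains exactly one end of [b]. *)
Lemma pendant_edge_bridge b : pendant_edge h b -> bridge b.
Proof.
move=> pb.
have outer u v : ends b = [set u; v] -> u = V K_v1 -> v \notin codom V.
  move=> bE uE; apply/negP=> /codomP[x vx]; subst u v.
  have [xv1|/inner_star[e1 [e2 [e3 sx]]]] := eqVneq x K_v1.
    by have := card_ends b; rewrite bE xv1 setUid cards1.
  have [|i bi] := edges_at_copy (b := b) sx; first by rewrite bE set22.
  by case: pb => _ /(_ i); rewrite bi.
move=> u v bE; apply/negP=> /(closed_connect (closed_copy pb)).
have := pb.1; rewrite bE !inE => /orP[]/eqP vE.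
  by rewrite -vE codom_f (negPf (outer _ _ bE (esym vE))).
by rewrite -vE codom_f (negPf (outer v u _ (esym vE))) // setUC.
Qed.

Lemma flanked_copy e x y z w :
  @flanked K_graph e x y z w -> flanked (E e) (E x) (E y) (E z) (E w).
Proof.
move=> [u [v [uv su sv]]]; exists (V u), (V v); split.
- by rewrite (inj_eq (@on_vertex_inj _ _ h)).
- exact: star_copy su.
- exact: star_copy sv.
Qed.

(** The permutation hypothesis treats [v1v2] and [v1v3] at once. *)
Lemma flanked_pendant b e f x y : pendant_edge h b ->
    perm_eq [:: e; f] [:: K_e12; K_e13] ->
    (exists2 u : vertex K_graph, u != K_v1 & star u [:: e; x; y]) ->
  flanked (E e) (E f) b (E x) (E y).
Proof.
move=> pb ef [u uv su]; exists (V K_v1), (V u); split.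
- by rewrite (inj_eq (@on_vertex_inj _ _ h)) eq_sym.
- have sP : perm_eq [:: E e; E f; b] [:: E K_e12; E K_e13; b].
    by rewrite -[X in perm_eq X]/(map E [:: e; f] ++ [:: b])
      -[X in perm_eq _ X]/(map E [:: K_e12; K_e13] ++ [:: b])
      perm_cat2r perm_map.
  by rewrite /star (perm_uniq sP) (perm_all _ sP); apply: pendant_edge_star.
- exact: star_copy su.
Qed.

(** * Colors and richness on the copy in a normal coloring *)

Section NormalColoring.

Variables (k : nat) (c : edge G -> 'I_k) (b : edge G).
Hypotheses (nc : normal_coloring c) (pb : pendant_edge h b).

Let flanked12 : flanked (E K_e12) (E K_e13) b (E K_e24) (E K_e25).
Proof.
by apply: flanked_pendant => //; exists K_v2; rewrite // /star /= !inE.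
Qed.

Let flanked13 : flanked (E K_e13) (E K_e12) b (E K_e34) (E K_e35).
Proof.
by apply: flanked_pendant => //; exists K_v3; rewrite // /star /= !inE.
Qed.

Let flanked24 :
  flanked (E K_e24) (E K_e12) (E K_e25) (E K_e34) (E K_e45).
Proof.
by apply: flanked_copy; exists K_v2, K_v4; rewrite /star /= !inE.
Qed.

Let flanked25 :
  flanked (E K_e25) (E K_e12) (E K_e24) (E K_e35) (E K_e45).
Proof.
by apply: flanked_copy; exists K_v2, K_v5; rewrite /star /= !inE.
Qed.

Let flanked34 :
  flanked (E K_e34) (E K_e13) (E K_e35) (E K_e24) (E K_e45).
Proof.
by apply: flanked_copy; exists K_v3, K_v4; rewrite /star /= !inE.
Qed.

Let flanked35 :
  flanked (E K_e35) (E K_e13) (E K_e34) (E K_e25) (E K_e45).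
Proof.
by apply: flanked_copy; exists K_v3, K_v5; rewrite /star /= !inE.
Qed.

Let flanked45 :
  flanked (E K_e45) (E K_e24) (E K_e34) (E K_e25) (E K_e35).
Proof.
by apply: flanked_copy; exists K_v4, K_v5; rewrite /star /= !inE.
Qed.

Let colors_distinct :
  uniq [:: c (E K_e12); c (E K_e13); c (E K_e24); c (E K_e25); c (E K_e34);
           c (E K_e35); c (E K_e45)] &&
  (c b \notin [:: c (E K_e12); c (E K_e13); c (E K_e24); c (E K_e25);
                  c (E K_e34); c (E K_e35)]).
Proof.
have star_uniq x e f g : star x [:: e; f; g] ->
    uniq [:: c (E e); c (E f); c (E g)].
  by move=> /star_copy; apply: uniq_star_colors nc.1.
apply: K_colors_distinct.
- exact: uniq_star_colors nc.1 (pendant_edge_star pb).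
- by apply: (star_uniq K_v2); rewrite /star /= !inE.
- by apply: (star_uniq K_v3); rewrite /star /= !inE.
- by apply: (star_uniq K_v4); rewrite /star /= !inE.
- by apply: (star_uniq K_v5); rewrite /star /= !inE.
- exact: flanked_normal nc flanked12.
- exact: flanked_normal nc flanked13.
- exact: flanked_normal nc flanked24.
- exact: flanked_normal nc flanked25.
- exact: flanked_normal nc flanked34.
- exact: flanked_normal nc flanked35.
- exact: flanked_normal nc flanked45.
Qed.

Lemma copy_colors_inj : injective (fun e => c (E e)).
Proof.
have /andP[u7 _] := colors_distinct => e f.
have K_edges i : i \in [:: K_e12; K_e13; K_e24; K_e25; K_e34; K_e35; K_e45].
  by elim/K_edge_ind: i; rewrite !inE.
have inj_c : {in [:: K_e12; K_e13; K_e24; K_e25; K_e34; K_e35; K_e45] &,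
    injective (fun e => c (E e))} by apply: uniq_map_inj_in.
exact: inj_c.
Qed.

(** Richness is read back from the distinct colors. The pendant edge flanks only [v1v2] and [v1v3],
    opposite edges other than [v4v5], from which its color is known to differ. *)
Lemma copy_rich e : rich c (E e).
Proof.
have inj_c := inj_eq copy_colors_inj.
have /andP[_] := colors_distinct; rewrite !inE !negb_or.
case/and5P=> b12 b13 b24 b25 /andP[b34 b35].
by elim/K_edge_ind: e; [
    apply: flanked_rich flanked12 _ | apply: flanked_rich flanked13 _
  | apply: flanked_rich flanked24 _ | apply: flanked_rich flanked25 _
  | apply: flanked_rich flanked34 _ | apply: flanked_rich flanked35 _
  | apply: flanked_rich flanked45 _ ];
  rewrite /disjoint_pair ?inj_c ?b24 ?b25 ?b34 ?b35 //; exact: nc.1.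
Qed.

Lemma copy_color_pendant e : c (E e) = c b -> e = K_e45.
Proof.
have /andP[_] := colors_distinct; move=> bN cE; rewrite -cE in bN.
by elim/K_edge_ind: e bN {cE}; rewrite // !inE !eqxx ?orbT.
Qed.

End NormalColoring.

End CopyOfK.

Theorem theorem3 (G : multigraph) (hG : cubic G)
    (h : subgraph_copy K_graph G) :
  exists b : edge G,
    (* b is the edge at v_1 outside K, and it is a bridge *)
    (forall b' : edge G, pendant_edge h b' <-> b' = b) /\
    bridge b /\
    (* (a) *)
    (forall (k : nat) (c : edge G -> 'I_k), normal_coloring c ->
       forall e : edge K_graph, rich c (on_edge h e)) /\
    (* (b) *)
    (forall (k : nat) (c : edge G -> 'I_k), normal_coloring c ->
       forall e f : edge K_graph, e <> f ->
         c (on_edge h e) <> c (on_edge h f)) /\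
    (* (c) *)
    ((forall n : nat, normal_index G n -> 7 <= n) /\
     (forall k : nat, k <= 6 -> ~ normal_colorable G k)) /\
    (* (d) *)
    (forall c : edge G -> 'I_7, normal_coloring c ->
       c (on_edge h K_e45) = c b).
Proof.
have [b bP] := pendant_edge_exists hG h.
have pb : pendant_edge h b by apply/bP.
(* The coloring injects the seven edges of the copy into the [k] colors. *)
have le7 k : normal_colorable G k -> 7 <= k.
  by move=> [c nc]; have := leq_card _ (copy_colors_inj hG nc pb);
     rewrite !card_ord.
exists b; split=> //; split; first exact: pendant_edge_bridge pb.
split; first by move=> k c nc e; exact: (copy_rich hG nc pb).
split; first by move=> k c nc e f ef /(copy_colors_inj hG nc pb).
split; first split.
- by move=> n [/le7].
- by move=> k k6 /le7; rewrite leqNgt ltnS k6.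
move=> c nc.
(* With exactly seven colors that injection is onto, so the color of [b] occurs on the copy, and
   only [v4v5] can carry it. *)
have /codomP[e cbE] : c b \in codom (fun e => c (on_edge h e)).
  by apply: inj_card_onto; [apply: copy_colors_inj pb | rewrite !card_ord].
by rewrite cbE (copy_color_pendant hG nc pb (esym cbE)).
Qed.
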